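(* Let $p$ and $q$ be distinct primes and let $s,t\ge 1$ be integers. The Laplacian spectrum of the Co-Prime Order graph $\Theta(\mathbb{Z}_p^t\times\mathbb{Z}_q^s)$ of the group $\mathbb{Z}_p^t\times\mathbb{Z}_q^s$ consists of $0$ with multiplicity $1$, $p^tq^s$ with multiplicity $p^t+q^s-1$, and $p^t+q^s-1$ with multiplicity $p^tq^s-p^t-q^s$.
   Context: For a finite group $G$, the Co-Prime Order graph $\Theta(G)$ is the simple undirected graph with vertex set $G$ in which two distinct vertices $x,y$ are adjacent if and only if $\gcd(o(x),o(y))$ is $1$ or a prime, where $o(x)$ is the order of $x$. The Laplacian matrix of a finite simple graph $\Gamma$ is $L(\Gamma)=D(\Gamma)-A(\Gamma)$, with $D(\Gamma)$ the diagonal matrix of vertex degrees and $A(\Gamma)$ the adjacency matrix; the Laplacian spectrum is the multiset of eigenvalues of $L(\Gamma)$ (roots of its characteristic polynomial with multiplicity). $\mathbb{Z}_p^t$ is the direct product of $t$ copies of the cyclic group of order $p$. *)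

(* Defs.v *)
From mathcomp Require Import all_boot all_order all_fingroup all_algebra all_field.

Set Implicit Arguments.
Unset Strict Implicit.
Unset Printing Implicit Defensive.

Import GRing.Theory.
Local Open Scope ring_scope.

Record sgraph (T : finType) := SGraph {
  adj :> rel T;
  adj_sym : symmetric adj;
  adj_irrefl : irreflexive adj
}.

Definition degree (T : finType) (e : sgraph T) (x : T) : nat :=
  #|[set y | e x y]|.

(* Vertices are numbered by [enum_val : 'I_#|T| -> T]; another numbering would
   only conjugate the matrices below by a permutation matrix. *)
Definition adjacency_mx (R : nzRingType) (T : finType) (e : sgraph T) :
    'M[R]_#|T| :=
  \matrix_(i, j) (e (enum_val i) (enum_val j))%:R.

Definition degree_mx (R : nzRingType) (T : finType) (e : sgraph T) :
    'M[R]_#|T| :=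
  diag_mx (\row_i (degree e (enum_val i))%:R).

Definition laplacian_mx (R : nzRingType) (T : finType) (e : sgraph T) :
    'M[R]_#|T| :=
  degree_mx R e - adjacency_mx R e.

(* Multisets are sequences considered up to [perm_eq]. *)
Definition spectrum (n : nat) (M : 'M[algC]_n) : seq algC :=
  sval (closed_field_poly_normal (char_poly M)).

Lemma char_poly_spectrum (n : nat) (M : 'M[algC]_n) :
  char_poly M = \prod_(z <- spectrum M) ('X - z%:P).
Proof.
rewrite /spectrum; case: closed_field_poly_normal => s /= {1}->.
by rewrite (monicP (char_poly_monic M)) scale1r.
Qed.

Definition laplacian_spectrum (T : finType) (e : sgraph T) : seq algC :=
  spectrum (laplacian_mx algC e).

Definition coprime_order_rel (gT : finGroupType) : rel gT :=
  fun x y => (x != y) &&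
    let d := gcdn #[x]%g #[y]%g in (d == 1)%N || prime d.

Lemma coprime_order_sym (gT : finGroupType) :
  symmetric (@coprime_order_rel gT).
Proof. by move=> x y; rewrite /coprime_order_rel eq_sym gcdnC. Qed.

Lemma coprime_order_irrefl (gT : finGroupType) :
  irreflexive (@coprime_order_rel gT).
Proof. by move=> x; rewrite /coprime_order_rel eqxx. Qed.

Definition coprime_order_graph (gT : finGroupType) : sgraph gT :=
  SGraph (@coprime_order_sym gT) (@coprime_order_irrefl gT).

(* The canonical [finGroupType] law on row vectors is their addition.  For
   [p <= 1], ['Z_p] is the ring of integers modulo 2. *)
Definition Zpow (p t : nat) : finGroupType := 'rV['Z_p]_t.

Definition ZpowX (p t q s : nat) : finGroupType := (Zpow p t * Zpow q s)%type.

(* Main.v *)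
Require Import Defs.
From mathcomp Require Import all_boot all_order all_fingroup all_algebra all_field.
From mathcomp Require Import cyclic.
From mathcomp Require Import zify.
Import GRing.Theory.
Local Open Scope ring_scope.

(** The order of a pair (a, b) in Z_p^t x Z_q^s is p or 1 times q or 1, according
    to whether a and b are trivial.  The gcd of two orders is therefore 1 or a
    prime unless both orders are p q: with M the set of pairs whose two
    components are nontrivial, the only missing edges are those inside M
    ([coprime_order_rel_prime_exponents]).  So the graph is the join of a
    complete graph on the complement of M, which has p^t + q^s - 1 vertices, and
    an empty graph on M, which has (p^t - 1)(q^s - 1) vertices.

    For such a join on N vertices, a of them outside M, the Laplacian is
    diagonalised explicitly ([laplacian_spectrum_complete_split]).  Fix m0 in M.
    The constant function 1 has eigenvalue 0; for each i outside M, N 1_i - 1 has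
    eigenvalue N; for each i in M other than m0, 1_i - 1_m0 has eigenvalue a.
    There are as many of these functions as vertices, and only the zero function
    is orthogonal to all of them, so they form an eigenbasis and their
    eigenvalues are the whole spectrum ([laplacian_spectrum_eigenbasis]). *)

(** * Spectra from eigenbases *)

(** From M Q = Q D follows (X - M) Q = Q (X - D) over the polynomials; taking
    determinants and cancelling det Q, which is nonzero, avoids inverting Q. *)

Lemma char_poly_eigenbasis (F : fieldType) (n : nat) (M Q : 'M[F]_n)
    (d : 'rV[F]_n) :
  row_free Q -> M *m Q = Q *m diag_mx d ->
  char_poly M = \prod_(i < n) ('X - (d 0 i)%:P).
Proof.
rewrite row_free_unit => Qu MQ.
have detQ : \det (map_mx polyC Q) != 0.
  by rewrite det_map_mx polyC_eq0 -unitfE -unitmxE.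
have eqQ : char_poly_mx M *m map_mx polyC Q
           = map_mx polyC Q *m char_poly_mx (diag_mx d).
  by rewrite mulmxBl mulmxBr -!map_mxM MQ scalar_mxC.
have := congr1 determinant eqQ; rewrite !det_mulmx mulrC => /(mulfI detQ).
rewrite -/(char_poly M) -/(char_poly (diag_mx d)) => ->.
rewrite char_poly_trig ?diag_mx_is_trig //.
by apply: eq_bigr => i _; rewrite mxE eqxx.
Qed.

(** The Laplacian as a difference operator: this form lets eigenfunctions be
    handled on the vertices themselves, without their numbering. *)
Lemma laplacian_mx_sum (R : nzRingType) (T : finType) (e : sgraph T) (i : 'I_#|T|)
    (f : T -> R) :
  \sum_j laplacian_mx R e i j * f (enum_val j)
    = \sum_(x | e (enum_val i) x) (f (enum_val i) - f x).
Proof.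
rewrite sumrB sumr_const -mulr_natl.
have -> : #|[pred x | e (enum_val i) x]| = degree e (enum_val i).
  by rewrite /degree cardsE.
under eq_bigr => j _ do rewrite !mxE mulrBl.
rewrite sumrB; congr (_ - _).
  rewrite (bigD1 i) //= eqxx mulr1n big1 ?addr0 // => j.
  by rewrite eq_sym => /negPf ->; rewrite mul0r.
rewrite -(big_enum_val (fun x => (e (enum_val i) x)%:R * f x)) big_mkcond /=.
rewrite [RHS]big_mkcond /=; apply: eq_bigr => x _.
by case: (e _ x); rewrite ?mul1r ?mul0r.
Qed.

(** The second hypothesis is the nondegeneracy of the family v: as it has exactly
    one member per vertex, having no nonzero orthogonal function makes it a
    basis. *)
Lemma laplacian_spectrum_eigenbasis (T : finType) (e : sgraph T)
    (v : T -> T -> algC) (d : T -> algC) :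
    (forall i y, \sum_(x | e y x) (v i y - v i x) = d i * v i y) ->
    (forall c : T -> algC,
       (forall i, \sum_x c x * v i x = 0) -> forall x, c x = 0) ->
  perm_eq (laplacian_spectrum e) [seq d i | i <- enum T].
Proof.
move=> v_eigen v_span; apply: prod_XsubC_eq.
pose Q := \matrix_(y < #|T|, i < #|T|) v (enum_val i) (enum_val y).
pose D := \row_(i < #|T|) d (enum_val i).
rewrite -char_poly_spectrum (@char_poly_eigenbasis _ _ _ Q D).
- rewrite big_map big_enum /= (big_enum_val (fun i => 'X - (d i)%:P)).
  by apply: eq_bigr => i _; rewrite mxE.
- apply: inj_row_free => r rQ0; apply/rowP => j; rewrite mxE.
  have := v_span (fun x => r 0 (enum_rank x)) _ (enum_val j).
  rewrite enum_valK; apply=> i.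
  have /rowP/(_ (enum_rank i)) := rQ0; rewrite !mxE => rQi0.
  rewrite -[RHS]rQi0 (reindex _ (onW_bij _ (enum_val_bij T))).
  by apply: eq_bigr => k _; rewrite !mxE enum_valK enum_rankK.
- apply/matrixP => y i; rewrite mul_mx_diag !mxE mulrC -v_eigen.
  rewrite -laplacian_mx_sum.
  by apply: eq_bigr => k _; rewrite !mxE.
Qed.

(** * Joins of a complete graph and an empty graph *)

(** Graphs of this shape are the complete split graphs.  On a function f the
    Laplacian takes at y the value #|T| f(y) - sum f when y is outside M, and
    #|~: M| f(y) - sum_(x outside M) f(x) when y is in M; each eigenfunction is
    checked against these two formulas. *)
Lemma laplacian_spectrum_complete_split (T : finType) (e : sgraph T)
    (M : {set T}) (m0 : T) :
    m0 \in M ->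
    (forall x y, e x y = (x != y) && ~~ ((x \in M) && (y \in M))) ->
  perm_eq (laplacian_spectrum e)
    (nseq 1 0 ++ nseq #|~: M| #|T|%:R ++ nseq #|M|.-1 #|~: M|%:R).
Proof.
move=> m0M eE.
pose d x : algC :=
  if x == m0 then 0 else if x \in M then #|~: M|%:R else #|T|%:R.
pose v i x : algC :=
  if i == m0 then 1 else if i \in M then (x == i)%:R - (x == m0)%:R
  else #|T|%:R * (x == i)%:R - 1.
have sum_ind (c : T -> algC) i : \sum_x c x * (x == i)%:R = c i.
  rewrite (bigD1 i) //= eqxx mulr1 big1 ?addr0 // => j /negPf ->.
  by rewrite mulr0.
have sum_ind1 (P : pred T) i : \sum_(x | P x) (x == i)%:R = (P i)%:R :> algC.
  rewrite big_mkcond -(sum_ind (fun x => (P x)%:R)) /=.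
  by apply: eq_bigr => x _; case: (P x); rewrite ?mul1r ?mul0r.
have v_eigen i y : \sum_(x | e y x) (v i y - v i x) = d i * v i y.
  have [yM | yNM] := boolP (y \in M).
    have -> : \sum_(x | e y x) (v i y - v i x)
              = #|~: M|%:R * v i y - \sum_(x | x \notin M) v i x.
      rewrite (eq_bigl (fun x => x \notin M)) => [|x]; last first.
        rewrite eE yM /=; case: eqP => [<-|] //.
        by rewrite yM.
      rewrite sumrB sumr_const mulr_natl; congr (_ *+ _ - _).
      by apply: eq_card => x; rewrite !inE.
    rewrite /v /d; case: eqP => [_|/eqP im0].
      rewrite mul0r sumr_const mulr1 (_ : #|_| = #|~: M|) ?subrr //.
      by apply: eq_card => x; rewrite !inE.
    case: ifP => iM; first by rewrite sumrB !sum_ind1 iM m0M !subr0.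
    have /negPf -> : y != i by apply: contraFneq iM => <-.
    rewrite sumrB -mulr_sumr sum_ind1 iM sumr_const.
    rewrite (_ : #|_| = #|~: M|); last by apply: eq_card => x; rewrite !inE.
    by rewrite !mulr0 mulr1 sub0r !mulrN1 opprB addKr.
  have -> : \sum_(x | e y x) (v i y - v i x) = #|T|%:R * v i y - \sum_x v i x.
    transitivity (\sum_x (v i y - v i x)).
      rewrite [RHS](bigD1 y) //= subrr add0r; apply: eq_bigl => x.
      by rewrite eE (negPf yNM) andbT eq_sym.
    by rewrite sumrB sumr_const mulr_natl.
  rewrite /v /d; case: eqP => [_|/eqP im0].
    by rewrite mul0r sumr_const !mulr1 subrr.
  case: ifP => iM.
    have /negPf -> : y != i by apply: contraNneq yNM => ->.
    have /negPf -> : y != m0 by apply: contraNneq yNM => ->.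
    by rewrite sumrB !sum_ind1 !subrr !mulr0 subr0.
  by rewrite sumrB -mulr_sumr sum_ind1 sumr_const mulr1 subrr subr0.
have v_span (c : T -> algC) :
    (forall i, \sum_x c x * v i x = 0) -> forall x, c x = 0.
  move=> cv.
  have natF_neq0 (n : nat) : (0 < n)%N -> (n%:R != 0 :> algC).
    by rewrite Num.Theory.pnatr_eq0 -lt0n.
  have sum_c : \sum_x c x = 0.
    by rewrite -[RHS](cv m0) /v eqxx; apply: eq_bigr => x _; rewrite mulr1.
  (* Pairing c, whose sum is 0, with #|T| 1_x - 1 gives #|T| c(x). *)
  have cN x : x \notin M -> c x = 0.
    move=> xNM; have xm0 : x != m0 by apply: contraNneq xNM => ->.
    have := cv x; rewrite /v (negPf xm0) (negPf xNM).
    under eq_bigr => y _ do rewrite mulrBr mulrCA mulr1.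
    rewrite sumrB -mulr_sumr sum_ind sum_c subr0 => /eqP.
    rewrite mulf_eq0 => /orP[|/eqP //].
    by rewrite (negPf (natF_neq0 _ _)) //; apply/card_gt0P; exists x.
  (* Pairing c with 1_x - 1_m0 shows that c is constant on M, so its total sum 0
     is #|M| c(m0). *)
  have cM x : x \in M -> c x = c m0.
    move=> xM; have [-> //|xm0] := eqVneq x m0.
    have := cv x; rewrite /v (negPf xm0) xM.
    under eq_bigr => y _ do rewrite mulrBr.
    by rewrite sumrB !sum_ind => /eqP; rewrite subr_eq0 => /eqP.
  have cm0 : c m0 = 0.
    move: sum_c; rewrite (bigID (mem M)) /= addrC big1 // add0r.
    rewrite (eq_bigr (fun=> c m0)) // sumr_const -mulr_natl => /eqP.
    rewrite mulf_eq0 => /orP[|/eqP //].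
    by rewrite (negPf (natF_neq0 _ _)) //; apply/card_gt0P; exists m0.
  by move=> x; have [/cM -> //|/cN //] := boolP (x \in M).
(* Two multisets of roots agree as soon as the polynomials they define do, which
   turns the count of the values of d into a split product over the vertices. *)
rewrite (permPl (@laplacian_spectrum_eigenbasis _ e v d v_eigen v_span)).
apply: prod_XsubC_eq; rewrite big_map big_enum /= (bigD1 m0) //=.
rewrite big_cons big_cat !big_nseq !iter_mulr_1 /d eqxx.
congr (_ * _); rewrite (bigID (mem M)) /= mulrC; congr (_ * _).
  rewrite (eq_bigr (fun=> 'X - #|T|%:R%:P)); last first.
    by move=> x /andP[/negPf -> /negPf ->].
  rewrite prodr_const; congr (_ ^+ _).
  apply: eq_card => x; rewrite -topredE /= !inE.
  by have [->|] := eqVneq x m0; rewrite ?m0M.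
rewrite (eq_bigr (fun=> 'X - #|~: M|%:R%:P)) => [|x /andP[/negPf -> ->] //].
rewrite prodr_const; congr (_ ^+ _).
rewrite (cardsD1 m0 M) m0M /=; apply: eq_card => x.
by rewrite !inE.
Qed.

(** * Element orders in a product of two groups of prime exponent *)

Lemma order_prime_exponent (gT : finGroupType) (p : nat) (x : gT) :
  prime p -> (x ^+ p = 1)%g -> #[x]%g = if x == 1%g then 1%N else p.
Proof.
move=> p_prime xp1; case: eqP => [->|/eqP x1]; first exact: order1.
exact: nt_prime_order.
Qed.

Lemma order_pair (gT1 gT2 : finGroupType) (x : gT1 * gT2) :
  #[x]%g = lcmn #[x.1]%g #[x.2]%g.
Proof.
have expg_pair n : (x ^+ n = (x.1 ^+ n, x.2 ^+ n))%g.
  elim: n => [|n IHn]; first by rewrite !expg0.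
  by rewrite !expgS IHn.
have order_dvd n : (#[x]%g %| n)%N = (lcmn #[x.1]%g #[x.2]%g %| n)%N.
  rewrite dvdn_lcm !order_dvdn expg_pair.
  by apply/eqP/andP => [[-> ->] | [/eqP -> /eqP ->]].
by apply/eqP; rewrite eqn_dvd order_dvd dvdnn -order_dvd dvdnn.
Qed.

(** Outside M an order is 1, p or q, so every divisor of it is 1 or a prime; in M
    all orders equal p q, hence so does their gcd. *)
Lemma coprime_order_rel_prime_exponents (gT1 gT2 : finGroupType) (p q : nat)
    (x y : gT1 * gT2) :
    prime p -> prime q -> p != q ->
    (forall a : gT1, a ^+ p = 1)%g -> (forall b : gT2, b ^+ q = 1)%g ->
  let M := [set z : gT1 * gT2 | (z.1 != 1%g) && (z.2 != 1%g)] in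
  coprime_order_rel x y = (x != y) && ~~ ((x \in M) && (y \in M)).
Proof.
move=> p_prime q_prime pq xp1 xq1 M; rewrite /coprime_order_rel; congr (_ && _).
have co_pq : coprime p q by rewrite prime_coprime // dvdn_prime2.
have ordM z : z \in M -> #[z]%g = (p * q)%N.
  rewrite inE order_pair => /andP[/negPf z1 /negPf z2].
  rewrite (order_prime_exponent _ p) // (order_prime_exponent _ q) // z1 z2.
  by have := muln_lcm_gcd p q; rewrite (eqP co_pq) muln1.
have ordNM z : z \notin M -> (#[z]%g == 1)%N || prime #[z]%g.
  rewrite inE order_pair.
  rewrite (order_prime_exponent _ p) // (order_prime_exponent _ q) //.
  case: (z.1 =P 1%g) => [_ _ | _] /=.
    by case: (z.2 =P 1%g) => _; rewrite lcm1n ?q_prime ?orbT.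
  by case: (z.2 =P 1%g) => // _ _; rewrite lcmn1 p_prime orbT.
have dvd1p n d : (n == 1)%N || prime n -> (d %| n)%N -> (d == 1)%N || prime d.
  case/orP => [/eqP -> | n_prime]; first by rewrite dvdn1 => ->.
  move=> dn; have [_ /(_ d dn)] := primeP n_prime.
  by case/orP => [-> | /eqP ->] //; rewrite n_prime orbT.
have [xM | /ordNM xNM] := boolP (x \in M); last exact: dvd1p xNM (dvdn_gcdl _ _).
have [yM | /ordNM yNM] := boolP (y \in M); last exact: dvd1p yNM (dvdn_gcdr _ _).
rewrite /= !ordM // gcdnn; apply/negP => /orP[].
  by rewrite muln_eq1 => /andP[/eqP p1 _]; rewrite p1 in p_prime.
case/primeP => _ /(_ p (dvdn_mulr _ (dvdnn p))) /orP[/eqP p1|].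
  by rewrite p1 in p_prime.
rewrite -{1}[p]muln1 eqn_pmul2l ?prime_gt0 // => /eqP q1.
by rewrite -q1 in q_prime.
Qed.

(** * Elementary abelian groups and the spectrum *)

Lemma Zpow_exponent (p t : nat) (x : Zpow p t) : prime p -> (x ^+ p = 1)%g.
Proof.
move=> p_prime; apply/rowP => i; rewrite FinRing.zmodXgE mulmxnE.
by rewrite -mulr_natr pchar_Zp ?prime_gt1 // mulr0 mxE.
Qed.

Lemma card_Zpow (p t : nat) : prime p -> #|Zpow p t| = (p ^ t)%N.
Proof.
by move=> p_prime; rewrite card_mx card_ord mul1n Zp_cast ?prime_gt1.
Qed.

Theorem theorem5 (p q s t : nat) (p_prime : prime p) (q_prime : prime q)
    (p_neq_q : p <> q) (s_ge1 : (1 <= s)%N) (t_ge1 : (1 <= t)%N) :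
  perm_eq (laplacian_spectrum (coprime_order_graph (ZpowX p t q s)))
    (nseq 1 (0 : algC)
     ++ nseq (p ^ t + q ^ s - 1)%N (p ^ t * q ^ s)%N%:R
     ++ nseq (p ^ t * q ^ s - p ^ t - q ^ s)%N (p ^ t + q ^ s - 1)%N%:R).
Proof.
pose M := [set z : ZpowX p t q s | (z.1 != 1%g) && (z.2 != 1%g)].
have pt_gt1 : (1 < p ^ t)%N by rewrite -(exp1n t) ltn_exp2r ?prime_gt1.
have qs_gt1 : (1 < q ^ s)%N by rewrite -(exp1n s) ltn_exp2r ?prime_gt1.
have cardT : #|ZpowX p t q s| = (p ^ t * q ^ s)%N.
  by rewrite card_prod !card_Zpow.
have cardM : #|M| = ((p ^ t).-1 * (q ^ s).-1)%N.
  have -> : M = setX [set~ 1%g] [set~ 1%g] by apply/setP => z; rewrite !inE.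
  by rewrite cardsX !cardsC1 !card_Zpow.
have [m0 m0M] : exists m0, m0 \in M.
  apply/card_gt0P; rewrite cardM muln_gt0.
  by case: (p ^ t)%N pt_gt1 (q ^ s)%N qs_gt1 => [|[|?]] // _ [|[|?]].
have adjE x y : coprime_order_graph (ZpowX p t q s) x y
                = (x != y) && ~~ ((x \in M) && (y \in M)).
  apply: (coprime_order_rel_prime_exponents _ _ p q) => //; first exact/eqP.
  - by move=> a; apply: Zpow_exponent.
  - by move=> b; apply: Zpow_exponent.
have := laplacian_spectrum_complete_split _ _ _ _ m0M adjE.
have cardMC : #|~: M| = (p ^ t + q ^ s - 1)%N.
  rewrite cardsCs setCK cardT cardM.
  by case: (p ^ t)%N pt_gt1 (q ^ s)%N qs_gt1 => [|a] // _ [|b] // _ /=; nia.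
rewrite cardMC cardT cardM.
suff -> : ((p ^ t).-1 * (q ^ s).-1).-1 = (p ^ t * q ^ s - p ^ t - q ^ s)%N by [].
by case: (p ^ t)%N pt_gt1 (q ^ s)%N qs_gt1 => [|a] // _ [|b] // _ /=; nia.
Qed.
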